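(* Let $n\ge1$. The class of $(\langle\ \rangle;,\mathsf A_1,\dots,\mathsf A_n,\cdot)$-algebras that are representable by $n$-ary partial functions is a variety, finitely axiomatised by the following equations (each universally quantified over all element variables occurring in it): (1) $\langle \boldsymbol a; b_1,\dots,\boldsymbol a; b_n\rangle ; c = \boldsymbol a;(\boldsymbol b; c)$; (2) $\boldsymbol\pi; a = a$; (3) $\langle \mathsf A_1^n a\rangle; a = 0$ (i.e. $\langle \mathsf A_1^n a\rangle; a=\langle \mathsf A_1^n b\rangle; b$ for all $a,b$, so that $0$ is a well-defined constant); (4) $\langle a_1,\dots,a_{i-1},0,a_{i+1},\dots,a_n\rangle; b = 0$ for every $i$; (5) $\boldsymbol a; 0 = 0$; (6) $\boldsymbol a;\mathsf A_i b = \langle \mathsf A_1^n(\boldsymbol a; b)\rangle;\langle \mathsf D_1^n a_1\rangle;\cdots;\langle \mathsf D_1^n a_n\rangle; a_i$ for every $i$; (7) $\langle \mathsf D_1^n a\rangle; a = a$; (8) $\mathsf A_i\mathsf A_j a=\mathsf A_i\mathsf A_k a$ for every $i,j,k$; (9) $a\cdot a=a$; (10) $a\cdot b=b\cdot a$; (11) $\boldsymbol a;(b\cdot c)=(\boldsymbol a; b)\cdot(\boldsymbol a; c)$; (12) $\langle \mathsf D_1^n(a\cdot b)\rangle; a=a\cdot b$; (13) $\langle a\bowtie_1 b,\dots,a\bowtie_n b\rangle; a=\langle a\bowtie_1 b,\dots,a\bowtie_n b\rangle; b$; (14) $\big(\boldsymbol\alpha;\mathsf D_i(\boldsymbol\alpha;(a\cdot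 b))\big) +_i \big(\boldsymbol\alpha;\langle \mathsf A_1^n(\boldsymbol\alpha; a)\rangle;\mathsf A_i(\boldsymbol\alpha; b)\big)=\boldsymbol\alpha;(a\bowtie_i b)$ for every $i$, where $\boldsymbol\alpha=\langle \mathsf A_1 d,\dots,\mathsf A_n d\rangle$ with $d$ an arbitrary element; (15) $\big(\langle \mathsf D_1^n a\rangle;(b\bowtie_i c)\big)+_i\big(\langle \mathsf A_1^n a\rangle;(b\bowtie_i c)\big)=b\bowtie_i c$ for every $i$.
   Context: Fix $n\ge 1$; indices $i,j,k$ range over $\{1,\dots,n\}$. The signature has an $(n+1)$-ary operation (composition), written $\langle a_1,\dots,a_n\rangle ; b$, unary operations $\mathsf A_1,\dots,\mathsf A_n$, and a binary operation $\cdot$. Algebras are nonempty. An $n$-ary partial function on a set $X$ is a set $f\subseteq X^{n+1}$ such that $(\boldsymbol x,y),(\boldsymbol x,z)\in f$ implies $y=z$ (where $\boldsymbol x\in X^n$). An algebra of $n$-ary partial functions of this signature is an algebra whose elements are $n$-ary partial functions, for which there are a set $X$ (the base) and an equivalence relation $E$ on $X$ such that every tuple $(x_1,\dots,x_{n+1})$ in every element lies in $X^{n+1}$ and has pairwise $E$-equivalent entries, and whose operations are $\boldsymbol f; g=\{(\boldsymbol x,z)\in X^{n+1} : \exists \boldsymbol y\in X^n,\ (\boldsymbol x,y_i)\in f_i \text{ for each } i \text{ and } (\boldsymbol y,z)\in g\}$, $\mathsf A_i(f)=\{(\boldsymbol x,x_i)\in X^{n+1} : x_1,\dots,x_n \text{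 all } E\text{-equivalent and there is no } y\in X \text{ with } (\boldsymbol x,y)\in f\}$, $f\cdot g=f\cap g$. An algebra is representable by $n$-ary partial functions if it is isomorphic to an algebra of $n$-ary partial functions of the same signature. Notation: a bold symbol $\boldsymbol a$ in a term $\boldsymbol a; b$ stands for $\langle a_1,\dots,a_n\rangle$; unbracketed compositions associate to the right ($\boldsymbol a;\boldsymbol b; c=\boldsymbol a;(\boldsymbol b; c)$); for unary operations $\mathsf B_1,\dots,\mathsf B_n$, $\langle \mathsf B_1^n a\rangle$ means $\langle \mathsf B_1 a,\dots,\mathsf B_n a\rangle$. Abbreviations: $0:=\langle \mathsf A_1^n b\rangle; b$ for any $b$; $\pi_i:=\mathsf A_i 0$; $\boldsymbol\pi:=\langle\pi_1,\dots,\pi_n\rangle$; $\mathsf D_i a:=\mathsf A_i\mathsf A_i a$; $\alpha+_i\beta:=\mathsf A_i(\langle \mathsf A_1^n\alpha\rangle;\mathsf A_i\beta)$; $a\bowtie_i b:=\mathsf D_i(a\cdot b)+_i(\langle \mathsf A_1^n a\rangle;\mathsf A_i b)$. *)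

(* Defs.v *)
From mathcomp Require Import all_boot.
From mathcomp Require Import boolp classical_sets.
From Stdlib Require RelationClasses List.

Set Implicit Arguments.
Unset Strict Implicit.
Unset Printing Implicit Defensive.

Local Open Scope classical_set_scope.

(** * Abstract algebras of the signature (<>;, A_1, ..., A_n, .) *)

(* Indices range over 'I_n, i.e. over 0, ..., n-1 instead of 1, ..., n. *)
Record algebra (n : nat) := Algebra {
  carrier :> Type;
  alg_comp : ('I_n -> carrier) -> carrier -> carrier;
  alg_anti : 'I_n -> carrier -> carrier;
  alg_meet : carrier -> carrier -> carrier;
  alg_nonempty : inhabited carrier
}.

Definition is_hom n (A B : algebra n) (h : A -> B) : Prop :=
  [/\ forall (f : 'I_n -> A) (g : A), h (alg_comp f g) = alg_comp (fun i => h (f i)) (h g),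
      forall (i : 'I_n) (f : A), h (alg_anti i f) = alg_anti i (h f)
    & forall f g : A, h (alg_meet f g) = alg_meet (h f) (h g)].

Definition isomorphic n (A B : algebra n) : Prop :=
  exists h : A -> B, is_hom h /\ bijective h.

Lemma forall_inhabited (I : Type) (T : I -> Type) :
  (forall i, inhabited (T i)) -> inhabited (forall i, T i).
Proof.
move=> inhT; constructor=> i.
have [x _] : {x : T i | True}.
  by apply: constructive_indefinite_description; case: (inhT i) => x; exists x.
exact: x.
Qed.

Definition prod_algebra n (I : Type) (A : I -> algebra n) : algebra n :=
  {| carrier := forall i, A i;
     alg_comp := fun f g => fun i => alg_comp (fun k => f k i) (g i);
     alg_anti := fun k f => fun i => alg_anti k (f i);
     alg_meet := fun f g => fun i => alg_meet (f i) (g i);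
     alg_nonempty := forall_inhabited (fun i => alg_nonempty (A i)) |}.

(* A class of algebras closed under homomorphic images, under (isomorphic
   copies of) subalgebras and under arbitrary, possibly empty, products. *)
Definition is_variety n (K : algebra n -> Prop) : Prop :=
  [/\ forall (A B : algebra n) (h : A -> B),
        is_hom h -> (forall b, exists a, h a = b) -> K A -> K B,
      forall (A B : algebra n) (h : B -> A), is_hom h -> injective h -> K A -> K B
    & forall (I : Type) (A : I -> algebra n), (forall i, K (A i)) -> K (prod_algebra A)].

(** * Algebras of n-ary partial functions *)

(* X^(n+1) is rendered as X^n * X, with X^n the type of functions 'I_n -> X. *)
Definition is_pfun n (X : Type) (f : set (('I_n -> X) * X)) : Prop :=
  forall x y z, f (x, y) -> f (x, z) -> y = z.

Definition pairwise_eqv n (X : Type) (E : X -> X -> Prop)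
    (f : set (('I_n -> X) * X)) : Prop :=
  forall x z, f (x, z) -> (forall i j, E (x i) (x j)) /\ (forall i, E (x i) z).

Definition pf_comp n (X : Type) (f : 'I_n -> set (('I_n -> X) * X))
    (g : set (('I_n -> X) * X)) : set (('I_n -> X) * X) :=
  [set p | exists y : 'I_n -> X, (forall i, f i (p.1, y i)) /\ g (y, p.2)].

Definition pf_antidom n (X : Type) (E : X -> X -> Prop) (i : 'I_n)
    (f : set (('I_n -> X) * X)) : set (('I_n -> X) * X) :=
  [set p | [/\ p.2 = p.1 i, forall j k, E (p.1 j) (p.1 k)
             & ~ exists y, f (p.1, y)]].

(* The base may be empty: this is how the one-element algebra arises. *)
Record pfun_algebra (n : nat) := PFunAlgebra {
  pf_base : Type;
  pf_eqv : pf_base -> pf_base -> Prop;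
  pf_eqv_equivalence : RelationClasses.Equivalence pf_eqv;
  pf_elts : set (set (('I_n -> pf_base) * pf_base));
  pf_elts_nonempty : pf_elts !=set0;
  pf_elts_pfun : forall f, pf_elts f -> is_pfun f;
  pf_elts_eqv : forall f, pf_elts f -> pairwise_eqv pf_eqv f;
  pf_elts_comp : forall f g, (forall i, pf_elts (f i)) -> pf_elts g -> pf_elts (pf_comp f g);
  pf_elts_antidom : forall i f, pf_elts f -> pf_elts (pf_antidom pf_eqv i f);
  pf_elts_meet : forall f g, pf_elts f -> pf_elts g -> pf_elts (f `&` g)
}.

Arguments pf_elts {n} p _.

Lemma pfun_algebra_inhabited n (P : pfun_algebra n) : inhabited {f | pf_elts P f}.
Proof. by case: (pf_elts_nonempty P) => f Pf; constructor; exists f. Qed.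

Definition algebra_of_pfuns n (P : pfun_algebra n) : algebra n :=
  {| carrier := {f | pf_elts P f};
     alg_comp := fun f g =>
       exist _ _ (pf_elts_comp (fun i => proj2_sig (f i)) (proj2_sig g));
     alg_anti := fun i f => exist _ _ (pf_elts_antidom i (proj2_sig f));
     alg_meet := fun f g => exist _ _ (pf_elts_meet (proj2_sig f) (proj2_sig g));
     alg_nonempty := pfun_algebra_inhabited P |}.

Definition representable n (A : algebra n) : Prop :=
  exists P : pfun_algebra n, isomorphic A (algebra_of_pfuns P).

(** * Terms and equations *)

Inductive term (n : nat) : Type :=
| Var of nat
| Comp of ('I_n -> term n) & term n
| Anti of 'I_n & term n
| Meet of term n & term n.

Arguments Var {n} _.

Fixpoint eval n (A : algebra n) (v : nat -> A) (t : term n) : A :=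
  match t with
  | Var x => v x
  | Comp ts u => alg_comp (fun i => eval v (ts i)) (eval v u)
  | Anti i u => alg_anti i (eval v u)
  | Meet u w => alg_meet (eval v u) (eval v w)
  end.

Record equation (n : nat) := Equation { lhs : term n; rhs : term n }.

Definition satisfies n (A : algebra n) (e : equation n) : Prop :=
  forall v : nat -> A, eval v (lhs e) = eval v (rhs e).

Declare Scope mfun_scope.
Delimit Scope mfun_scope with mfun.
Local Open Scope mfun_scope.

Notation "ts ;; u" := (Comp ts u) (at level 39, right associativity) : mfun_scope.
Notation "t ⋅ u" := (Meet t u) (at level 38, left associativity) : mfun_scope.
Notation "t ≈ u" := (Equation t u) (at level 70, no associativity) : mfun_scope.

Section Equations.
Variable n : nat.
Implicit Types (i j k : 'I_n) (t u : term n).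

(* [Dom i] is D_i; [Antis t] is <A_1 t, ..., A_n t>; [Doms t] is <D_1 t, ..., D_n t>. *)
Definition Dom i t := Anti i (Anti i t).
Definition Antis t := fun i => Anti i t.
Definition Doms t := fun i => Dom i t.

(* Pairwise distinct variables. The variable 0 is kept for the constant 0,
   which is <A_1 b, ..., A_n b>; b for any b: [ax3] makes the choice of b
   immaterial. *)
Definition va : term n := Var 1.
Definition vb : term n := Var 2.
Definition vc : term n := Var 3.
Definition vd : term n := Var 4.
Definition avec i : term n := Var (5 + i).
Definition bvec i : term n := Var (5 + n + i).

Definition Zero : term n := Antis (Var 0) ;; Var 0.
Definition Proj i : term n := Anti i Zero.

Definition plus i t u := Anti i (Antis t ;; Anti i u).
Definition bowtie i t u := plus i (Dom i (t ⋅ u)) (Antis t ;; Anti i u).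

Definition ax1 := (fun i => avec ;; bvec i) ;; vc ≈ avec ;; bvec ;; vc.
Definition ax2 := Proj ;; va ≈ va.
Definition ax3 := Antis va ;; va ≈ Antis vb ;; vb.
Definition ax4 i := (fun j => if j == i then Zero else avec j) ;; vb ≈ Zero.
Definition ax5 := avec ;; Zero ≈ Zero.
(* The fold is <D_1 a_1, ..., D_n a_1>; ... ; <D_1 a_n, ..., D_n a_n>; a_i. *)
Definition ax6 i :=
  avec ;; Anti i vb ≈
  Antis (avec ;; vb) ;; foldr (fun j t => Doms (avec j) ;; t) (avec i) (enum 'I_n).
Definition ax7 := Doms va ;; va ≈ va.
Definition ax8 i j k := Anti i (Anti j va) ≈ Anti i (Anti k va).
Definition ax9 := va ⋅ va ≈ va.
Definition ax10 := va ⋅ vb ≈ vb ⋅ va.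
Definition ax11 := avec ;; (vb ⋅ vc) ≈ (avec ;; vb) ⋅ (avec ;; vc).
Definition ax12 := Doms (va ⋅ vb) ;; va ≈ va ⋅ vb.
Definition ax13 :=
  (fun i => bowtie i va vb) ;; va ≈ (fun i => bowtie i va vb) ;; vb.
Definition ax14 i :=
  plus i (Antis vd ;; Dom i (Antis vd ;; (va ⋅ vb)))
         (Antis vd ;; Antis (Antis vd ;; va) ;; Anti i (Antis vd ;; vb))
  ≈ Antis vd ;; bowtie i va vb.
Definition ax15 i :=
  plus i (Doms va ;; bowtie i vb vc) (Antis va ;; bowtie i vb vc) ≈ bowtie i vb vc.

Definition axioms : seq (equation n) :=
  [:: ax1; ax2; ax3; ax5; ax7; ax9; ax10; ax11; ax12; ax13]
  ++ [seq ax4 i | i <- enum 'I_n]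
  ++ [seq ax6 i | i <- enum 'I_n]
  ++ flatten [seq [seq ax8 i j k | j <- enum 'I_n, k <- enum 'I_n]
             | i <- enum 'I_n]
  ++ [seq ax14 i | i <- enum 'I_n]
  ++ [seq ax15 i | i <- enum 'I_n].

End Equations.

(* K is the class of models of the finite list s of equations. *)
Definition finitely_axiomatised_by n (K : algebra n -> Prop)
    (s : seq (equation n)) : Prop :=
  forall A : algebra n, K A <-> List.Forall (satisfies A) s.

(* Main.v *)
Require Import Defs.
From mathcomp Require Import all_boot.
From mathcomp Require Import boolp classical_sets.
From Stdlib Require RelationClasses List.

(** Soundness of the axioms is a computation with graphs, and a class defined
    by equations is closed under homomorphic images, subalgebras and products;
    so everything rests on showing that a model [A] of the axioms is
    representable.

    The idea is a Cayley representation modulo germs. Say that [restr d y] is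
    [y] restricted to the domain of [d], that is <D_1 d, ..., D_n d>; y. The
    axioms make these restrictions commute, compose like a meet operation, and
    have complements: the domains form a Boolean algebra. An ultrafilter [U] of
    it, viewed as a set of elements of [A] (those whose domain is large), gives
    the relation [germ U a b]: [a] and [b] agree when restricted to some member
    of [U]. An element [b] then acts on the germs of members of [U] by
    (x_1, ..., x_n) |-> <x_1, ..., x_n>; b, defined when the right-hand side is
    again a member of [U]. The law [law1] turns composition into composition of
    these partial functions, [law6] together with the dichotomy [U x] or
    [U (compl x)] handles A_i, and [law11] and [law12] handle the meet. The
    base of the representation is the disjoint union of these sets of germs
    over all ultrafilters, and two points are equivalent when they belong to
    the same ultrafilter ([theta_comp], [theta_anti], [theta_meet]).

    For faithfulness let a <> b. The terms a bowtie_i b describe the largest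
    domain on which [a] and [b] agree: by [law14], every [d] on which they agree
    lies below it, and by [law13] one of them is not everything, so its
    complement is a nonzero [c] disjoint from all such [d] ([separating_elt]). An
    ultrafilter containing [c] contains no such [d], so it tells the germs of
    [a] and [b] apart.

    The delicate point is the commutativity of restrictions. Manipulating
    compositions and antidomains by [law1]-[law8] gives the left-regular law
    xyx = xy ([outside_restr_outside]); the rest comes from [law15]: as A_i d is
    itself of the form d bowtie_i 0, this law says that a domain is the join of
    its parts inside and outside any other domain
    ([restr_of_outside_zero]). *)

Set Implicit Arguments.
Unset Strict Implicit.
Unset Printing Implicit Defensive.

Local Open Scope classical_set_scope.

(** * The axioms as identities between elements *)

Section ElementOperations.
Context {n : nat} {A : algebra n}.
Implicit Types (a b d y : A) (i : 'I_n).

(** On partial functions, [outside d y] is [y] restricted to the complement of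
    the domain of [d], and [inside a y] is [y] restricted to the domain of
    [a]. *)
Definition outside d y : A := alg_comp (fun i => alg_anti i d) y.
Definition dom i a : A := alg_anti i (alg_anti i a).
Definition inside a y : A := alg_comp (fun i => dom i a) y.
(** The i-th projection on the union of the two domains: the operation +_i. *)
Definition join i a b : A := alg_anti i (outside a (alg_anti i b)).
(** The operation bowtie_i. On partial functions, the i-th projection on the
    set of tuples where [a] and [b] have the same value or are both
    undefined. *)
Definition agree i a b : A :=
  join i (dom i (alg_meet a b)) (outside a (alg_anti i b)).

End ElementOperations.

(** The axioms with families ['I_n -> A] in place of the vectors of variables
    [avec] and [bvec]; [law]k is the k-th axiom, and [outside z z] is the
    constant 0. *)
Record laws n (A : algebra n) : Prop := Laws {
  law1 (f g : 'I_n -> A) (c : A) :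
    alg_comp (fun i => alg_comp f (g i)) c = alg_comp f (alg_comp g c);
  law2 (a z : A) : alg_comp (fun i => alg_anti i (outside z z)) a = a;
  law3 (a b : A) : outside a a = outside b b;
  law4 i (f : 'I_n -> A) (b z : A) :
    alg_comp (fun j => if j == i then outside z z else f j) b = outside z z;
  law5 (f : 'I_n -> A) (z : A) : alg_comp f (outside z z) = outside z z;
  law6 i (f : 'I_n -> A) (b : A) :
    alg_comp f (alg_anti i b) =
    outside (alg_comp f b)
      (foldr (fun j y => inside (f j) y) (f i) (enum 'I_n));
  law7 (a : A) : inside a a = a;
  law8 i j k (a : A) :
    alg_anti i (alg_anti j a) = alg_anti i (alg_anti k a);
  law9 (a : A) : alg_meet a a = a;
  law10 (a b : A) : alg_meet a b = alg_meet b a;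
  law11 (f : 'I_n -> A) (b c : A) :
    alg_comp f (alg_meet b c) = alg_meet (alg_comp f b) (alg_comp f c);
  law12 (a b : A) : inside (alg_meet a b) a = alg_meet a b;
  law13 (a b : A) :
    alg_comp (fun i => agree i a b) a = alg_comp (fun i => agree i a b) b;
  law14 i (a b d : A) :
    join i (outside d (dom i (outside d (alg_meet a b))))
           (outside d (outside (outside d a) (alg_anti i (outside d b))))
    = outside d (agree i a b);
  law15 i (a b c : A) :
    join i (inside a (agree i b c)) (outside a (agree i b c)) = agree i b c
}.

Lemma Forall_map_mem (I : eqType) T (Q : T -> Prop) (F : I -> T) (s : seq I) :
  List.Forall Q [seq F i | i <- s] <-> forall i, i \in s -> Q (F i).
Proof.
elim: s => [|x s IH] /=; first by split => // _; constructor.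
split=> [/List.Forall_cons_iff[Qx /IH Qs] i|Qs].
  by rewrite inE => /orP[/eqP->|/Qs].
constructor; first by apply: Qs; rewrite mem_head.
by apply/IH => i si; apply: Qs; rewrite inE si orbT.
Qed.

Lemma Forall_map_enum n T (Q : T -> Prop) (F : 'I_n -> T) :
  List.Forall Q [seq F i | i <- enum 'I_n] <-> forall i, Q (F i).
Proof.
apply: iff_trans (Forall_map_mem _ _ _) _.
by split=> QF i => [|_]; apply: QF; rewrite ?mem_enum.
Qed.

Lemma Forall_cat T (Q : T -> Prop) (s1 s2 : seq T) :
  List.Forall Q (s1 ++ s2) <-> List.Forall Q s1 /\ List.Forall Q s2.
Proof.
elim: s1 => [|x s1 IH] /=; first by split=> [|[]//]; split.
by rewrite !List.Forall_cons_iff IH; tauto.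
Qed.

Lemma Forall_flatten T (Q : T -> Prop) (ss : seq (seq T)) :
  List.Forall Q (flatten ss) <-> List.Forall (List.Forall Q) ss.
Proof.
elim: ss => [|s ss IH] /=; first by split=> _; constructor.
rewrite Forall_cat IH; split=> [[Qs Qss]|/List.Forall_cons_iff//].
by constructor.
Qed.

Section AxiomsAsLaws.
Variables (n : nat) (A : algebra n).

Lemma Forall_axioms (Q : equation n -> Prop) :
  List.Forall Q (axioms n) <->
  (((Q (ax1 n) /\ Q (ax2 n) /\ Q (ax3 n) /\ Q (ax5 n) /\ Q (ax7 n) /\
    Q (ax9 n) /\ Q (ax10 n) /\ Q (ax11 n) /\ Q (ax12 n) /\ Q (ax13 n)) /\
   (forall i, Q (ax4 i)) /\ (forall i, Q (ax6 i)) /\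
   (forall i j k, Q (ax8 i j k)) /\ (forall i, Q (ax14 i)) /\
   (forall i, Q (ax15 i)))).
Proof.
rewrite /axioms !Forall_cat !Forall_map_enum Forall_flatten Forall_map_enum.
rewrite !List.Forall_cons_iff.
have E : (forall i, List.Forall Q
    [seq ax8 i j k | j <- enum 'I_n, k <- enum 'I_n]) <->
    forall i j k, Q (ax8 i j k).
  split=> H i; first move=> j k.
    move: (H i); rewrite Forall_flatten Forall_map_enum => /(_ j).
    by rewrite Forall_map_enum.
  rewrite Forall_flatten Forall_map_enum => j.
  by rewrite Forall_map_enum.
rewrite E.
by have : List.Forall Q [::] by []; tauto.
Qed.

(** Any choice of elements is the value of the variables [Var 0] (reserved for
    the constant 0), [avec], [bvec], [va], [vb], [vc] and [vd] under a single
    valuation, because these variables are pairwise distinct. *)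
Lemma valuation_exists (f g : 'I_n -> A) (z a b c d : A) :
  exists v : nat -> A,
    [/\ f = (fun i => v (5 + i)), g = (fun i => v (5 + n + i)) &
       [/\ z = v 0, a = v 1, b = v 2, c = v 3 & d = v 4]].
Proof.
pose v k := if insub (k - 5) is Some i then f i else
            if insub (k - (5 + n)) is Some i then g i else z.
exists (fun k => match k with 0 => z | 1 => a | 2 => b | 3 => c | 4 => d
                 | _ => v k end).
split=> //; apply/funext => i; rewrite /v /=.
  by rewrite !addSn subSS !subSS subn0 valK.
rewrite !addSn !subSS subn0 insubF ?addKn ?valK //.
by rewrite ltnNge leq_addr.
Qed.

Lemma eval_foldr (v : nat -> A) (s : seq 'I_n) (t : term n) :
  eval v (foldr (fun j u => Comp (Doms (avec j)) u) t s) =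
  foldr (fun (j : 'I_n) y => inside (v (5 + j)) y) (eval v t) s.
Proof. by elim: s => //= j s ->. Qed.

Lemma eval_if (v : nat -> A) (c : bool) (t u : term n) :
  eval v (if c then t else u) = if c then eval v t else eval v u.
Proof. by case: c. Qed.

Lemma axioms_laws : List.Forall (satisfies A) (axioms n) <-> laws A.
Proof.
rewrite Forall_axioms; split.
  move=> [[h1 [h2 [h3 [h5 [h7 [h9 [h10 [h11 [h12 h13]]]]]]]]]
          [h4 [h6 [h8 [h14 h15]]]]].
  have [x0] := alg_nonempty A; pose f0 (i : 'I_n) := x0.
  split.
  - move=> f g c.
    have [v [-> -> [_ _ _ -> _]]] := valuation_exists f g x0 x0 x0 c x0.
    exact: (h1 v).
  - move=> a z.
    have [v [_ _ [-> -> _ _ _]]] := valuation_exists f0 f0 z a x0 x0 x0.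
    exact: (h2 v).
  - move=> a b.
    have [v [_ _ [_ -> -> _ _]]] := valuation_exists f0 f0 x0 a b x0 x0.
    exact: (h3 v).
  - move=> i f b z.
    have [v [-> _ [-> _ -> _ _]]] := valuation_exists f f0 z x0 b x0 x0.
    apply: etrans; last exact: (h4 i v).
    rewrite /=; congr alg_comp; apply/funext => j.
    by rewrite eval_if.
  - move=> f z.
    have [v [-> _ [-> _ _ _ _]]] := valuation_exists f f0 z x0 x0 x0 x0.
    exact: (h5 v).
  - move=> i f b.
    have [v [-> _ [_ _ -> _ _]]] := valuation_exists f f0 x0 x0 b x0 x0.
    by have := h6 i v; rewrite /= eval_foldr.
  - move=> a.
    have [v [_ _ [_ -> _ _ _]]] := valuation_exists f0 f0 x0 a x0 x0 x0.
    exact: (h7 v).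
  - move=> i j k a.
    have [v [_ _ [_ -> _ _ _]]] := valuation_exists f0 f0 x0 a x0 x0 x0.
    exact: (h8 i j k v).
  - move=> a.
    have [v [_ _ [_ -> _ _ _]]] := valuation_exists f0 f0 x0 a x0 x0 x0.
    exact: (h9 v).
  - move=> a b.
    have [v [_ _ [_ -> -> _ _]]] := valuation_exists f0 f0 x0 a b x0 x0.
    exact: (h10 v).
  - move=> f b c.
    have [v [-> _ [_ _ -> -> _]]] := valuation_exists f f0 x0 x0 b c x0.
    exact: (h11 v).
  - move=> a b.
    have [v [_ _ [_ -> -> _ _]]] := valuation_exists f0 f0 x0 a b x0 x0.
    exact: (h12 v).
  - move=> a b.
    have [v [_ _ [_ -> -> _ _]]] := valuation_exists f0 f0 x0 a b x0 x0.
    exact: (h13 v).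
  - move=> i a b d.
    have [v [_ _ [_ -> -> _ ->]]] := valuation_exists f0 f0 x0 a b x0 d.
    exact: (h14 i v).
  - move=> i a b c.
    have [v [_ _ [_ -> -> -> _]]] := valuation_exists f0 f0 x0 a b c x0.
    exact: (h15 i v).
move=> L; do ?split.
- move=> v; exact: (law1 L (fun i => v (5 + i)) (fun i => v (5 + n + i))).
- move=> v; exact: (law2 L).
- move=> v; exact: (law3 L).
- move=> v; exact: (law5 L).
- move=> v; exact: (law7 L).
- move=> v; exact: (law9 L).
- move=> v; exact: (law10 L).
- move=> v; exact: (law11 L).
- move=> v; exact: (law12 L).
- move=> v; exact: (law13 L).
- move=> i v; apply: etrans; last first.
    exact: (law4 L i (fun j => v (5 + j)) (v 2) (v 0)).
  rewrite /=; congr alg_comp; apply/funext => j.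
  by rewrite eval_if.
- move=> i v; apply: etrans; first exact: (law6 L i (fun j => v (5 + j)) (v 2)).
  by rewrite /= eval_foldr.
- move=> i j k v; exact: (law8 L).
- move=> i v; exact: (law14 L).
- move=> i v; exact: (law15 L).
Qed.

End AxiomsAsLaws.

Lemma elt_exists n (A : algebra n) : exists x : A, True.
Proof. by case: (alg_nonempty A) => x; exists x. Qed.

Definition some_elt n (A : algebra n) : A := projT1 (cid (elt_exists A)).

(** * The Boolean algebra of domains *)

Section BooleanTests.
Variables (n : nat) (A : algebra n) (L : laws A) (i0 : 'I_n).
Implicit Types (a b c d x y z : A) (i j k : 'I_n) (f g : 'I_n -> A).

Definition zero : A := outside (some_elt A) (some_elt A).
Definition proj i : A := alg_anti i zero.
(** By [law8] the elements A_1 d, ..., A_n d have the same domain, the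
    complement of that of [d]; the one at [i0] represents it. *)
Definition compl d : A := alg_anti i0 d.
Definition restr d y : A := outside (compl d) y.

Lemma outsidexx a : outside a a = zero.
Proof. exact: law3. Qed.

Lemma comp_zero_arg i f b : f i = zero -> alg_comp f b = zero.
Proof.
move=> fi0; rewrite -[RHS](law4 L i f b (some_elt A)); congr alg_comp.
apply/funext => j; by case: eqP => // ->.
Qed.

Lemma comp_zero f : alg_comp f zero = zero.
Proof. exact: law5. Qed.

Lemma outside_zero d : outside d zero = zero.
Proof. exact: comp_zero. Qed.

Lemma comp_proj a : alg_comp proj a = a.
Proof. exact: law2. Qed.

Lemma outside0 a : outside zero a = a.
Proof. exact: comp_proj. Qed.

Lemma outside_comp d f c :
  outside d (alg_comp f c) = alg_comp (fun i => outside d (f i)) c.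
Proof. by rewrite /outside law1. Qed.

Lemma insideE a y : inside a y = restr a y.
Proof.
by congr alg_comp; apply/funext => i; exact: (law8 L).
Qed.

Lemma anti_dom i j k d : alg_anti i (alg_anti j d) = alg_anti i (alg_anti k d).
Proof. exact: law8. Qed.

Lemma outside_anti_indep i j d y :
  outside (alg_anti i d) y = outside (alg_anti j d) y.
Proof. by congr alg_comp; apply/funext => k; exact: anti_dom. Qed.

Lemma inside_anti i d y : inside d y = outside (alg_anti i d) y.
Proof. by rewrite insideE; exact: outside_anti_indep. Qed.

Lemma restrxx a : restr a a = a.
Proof. by rewrite -insideE law7. Qed.

Lemma inside_anti_anti i j d :
  inside (alg_anti j d) (alg_anti i d) = alg_anti i d.
Proof.
apply: etrans (law7 L (alg_anti i d)); congr alg_comp; apply/funext => k.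
by rewrite /dom; congr alg_anti; exact: anti_dom.
Qed.

(** The law [law6] for the family A_1 d, ..., A_n d: the restrictions to the
    domains of its members are absorbed, as these all have the domain of A_i d. *)
Lemma outside_anti d i b :
  outside d (alg_anti i b) = outside (outside d b) (alg_anti i d).
Proof.
rewrite {1}/outside law6 //; congr outside.
elim: (enum _) => //= j s ->; exact: inside_anti_anti.
Qed.

(** Once everything is restricted to the complement of [d], being outside [b]
    depends only on the part of [b] outside [d]. Together with [outsidexx] and
    [outside0] this produces most of the identities below. *)
Lemma outside_outside d b c :
  outside d (outside b c) = outside (outside d b) (outside d c).
Proof.
rewrite outside_comp {4}/outside outside_comp; congr alg_comp.
by apply/funext => i; exact: outside_anti.
Qed.

Lemma anti_outside i d : alg_anti i d = outside d (proj i).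
Proof. by rewrite outside_anti outside_zero outside0. Qed.

Lemma complE d : compl d = outside d (proj i0).
Proof. exact: anti_outside. Qed.

Lemma outside_idem d c : outside d (outside d c) = outside d c.
Proof. by rewrite outside_outside outsidexx outside0. Qed.

Lemma outside_compl_anti d i : outside (compl d) (alg_anti i d) = zero.
Proof. by rewrite (outside_anti_indep _ i) outsidexx. Qed.

Lemma restr_outside d c : restr d (outside d c) = zero.
Proof.
rewrite /restr outside_comp; apply: (@comp_zero_arg i0).
exact: outside_compl_anti.
Qed.

Lemma outside_restr d c : outside d (restr d c) = zero.
Proof.
rewrite /restr outside_outside.
have -> : outside d (compl d) = compl d.
  by rewrite /compl outside_anti outsidexx outside0.
exact: restr_outside.
Qed.

(** Both sides equal [restr (compl d) (outside d c)]: [outside d] is absorbed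
    on the one hand since A_i d lies inside its own domain, and on the other
    because [d] vanishes on the domain of [compl d]. *)
Lemma restr_compl d c : restr (compl d) c = outside d c.
Proof.
have E y : restr (compl d) (outside d y) = outside d y.
  rewrite /restr outside_comp /outside; congr (alg_comp _ y); apply/funext => i.
  by have := inside_anti_anti i i0 d; rewrite insideE.
rewrite -[RHS]E /restr [RHS]outside_outside.
suff -> : outside (compl (compl d)) d = zero by rewrite outside0.
rewrite -/(restr (compl d) d).
by rewrite -{2}(restrxx d) {2}/restr restr_outside.
Qed.

Lemma anti_compl_compl i d : alg_anti i (compl (compl d)) = alg_anti i d.
Proof. by rewrite !anti_outside; exact: restr_compl. Qed.

(** The left-regular band law xyx = xy for restrictions, a precursor of their
    commutativity. *)
Lemma outside_restr_outside a b c :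
  outside a (outside b (outside a c)) = outside a (outside b c).
Proof. by rewrite outside_outside outside_idem -outside_outside. Qed.

Lemma outside_disjoint d b y :
  outside d (compl (compl b)) = zero -> outside d (outside b y) = outside d y.
Proof.
move=> d0; rewrite -(restr_compl b) /restr outside_outside d0; exact: outside0.
Qed.

(** Here [u] is [z] outside [a], so its domain is that of [z] minus that of
    [a]. The lemmas compare the restriction to [u] with the composite
    [outside a (restr z y)]: the former absorbs the latter, and the latter has
    no part outside [u]. Their equality is [restrA], which needs [law15]. *)
Section RestrictedDomain.
Variables a z : A.
Let u := outside a z.

Lemma restr_outside_absorb y : restr u (outside a y) = restr u y.
Proof.
apply: outside_disjoint; rewrite (complE (compl a)); set e := proj i0.
(* Outside [compl a], that is on the domain of [a], [u] vanishes; hence the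
   part of [e] there may be taken outside [u], where [restr u] kills it. *)
have <- : outside (compl a) (outside u e) = outside (compl a) e.
  by rewrite outside_outside -/(restr a u) restr_outside outside0.
rewrite -outside_restr_outside -!/(restr u _) (restr_outside u).
by rewrite /restr !outside_zero.
Qed.

Lemma restr_restr_absorb y : restr u (restr z y) = restr u y.
Proof.
apply: outside_disjoint; rewrite [compl (compl _)]anti_compl_compl.
rewrite -/(restr u _) -restr_outside_absorb -/(compl z) complE outside_outside.
exact: restr_outside.
Qed.

Lemma restr_outside_restr y : restr u (outside a (restr z y)) = restr u y.
Proof. by rewrite restr_outside_absorb restr_restr_absorb. Qed.

Lemma outside_outside_restr y : outside u (outside a (restr z y)) = zero.
Proof. by rewrite -outside_outside outside_restr outside_zero. Qed.

End RestrictedDomain.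

Lemma outside_anti_anti i j d y :
  outside (alg_anti i (alg_anti j d)) y = outside d y.
Proof.
rewrite (anti_dom i j i0) (outside_anti_indep i i0); exact: restr_compl.
Qed.

Lemma outside_anti_self i d : outside d (alg_anti i d) = alg_anti i d.
Proof. by rewrite outside_anti outsidexx outside0. Qed.

Lemma dom_outside i d : dom i d = restr d (proj i).
Proof. by rewrite -insideE (inside_anti i) -anti_outside. Qed.

Lemma dom_zero i : dom i zero = zero.
Proof.
rewrite dom_outside -[X in restr _ X](outside0 (proj i)); exact: restr_outside.
Qed.

Lemma meet_zero d : alg_meet d zero = zero.
Proof. rewrite (law10 L) -(law12 L) insideE; exact: outside_zero. Qed.

Lemma join_zero i a : join i a zero = dom i a.
Proof. by rewrite /join -/(proj i) -anti_outside. Qed.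

Lemma zero_join i a : join i zero a = dom i a.
Proof. by rewrite /join outside0. Qed.

(** Every A_i d is a bowtie term, so [law15] applies to it. *)
Lemma agree_zero i d : agree i d zero = alg_anti i d.
Proof.
rewrite /agree meet_zero dom_zero zero_join -/(proj i) -anti_outside.
rewrite /dom (anti_dom i i i0) (anti_dom i0 i i0); exact: anti_compl_compl.
Qed.

(** An element with no part outside [d] lies inside [d]. By [law15] each
    t_i = D_i z is the join of its parts inside and outside [d]; the second part
    is zero, so t_i is the domain of u = [restr d] t_i. Hence restricting to [u]
    is restricting to [z], and t_i = [restr u] t_i = [u] follows. Finally
    z = <t_1, ..., t_n>; z by [law7]. *)
Lemma restr_of_outside_zero d z : outside d z = zero -> restr d z = z.
Proof.
move=> dz0; pose t i := dom i z.
have zE y i : restr z y = outside (alg_anti i (t i)) y.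
  by rewrite outside_anti_anti -(inside_anti i) insideE.
have dt0 i : outside d (t i) = zero.
  rewrite outside_anti.
  have -> : outside d (alg_anti i z) = alg_anti i d.
    by rewrite outside_anti dz0 outside0.
  exact: outsidexx.
have tE i : t i = dom i (restr d (t i)).
  have := law15 L i d (alg_anti i z) zero.
  by rewrite agree_zero -/(dom i z) -/(t i) dt0 join_zero insideE.
have dt i : restr d (t i) = t i.
  set u := restr d (t i).
  have zu y : restr z y = restr u y.
    by rewrite (zE _ i) tE -/u outside_anti_anti -(inside_anti i) insideE.
  rewrite -(restrxx u) -[RHS](_ : restr u (t i) = t i).
    exact: restr_outside_absorb.
  by rewrite -zu -insideE (inside_anti i) /t /dom outside_anti_self.
have -> : restr d z = alg_comp (fun i => restr d (t i)) z.
  by rewrite /restr -outside_comp -/(inside z z) law7.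
rewrite (_ : (fun i => restr d (t i)) = t); last exact/funext.
exact: (law7 L).
Qed.

Lemma restrA x y z : restr x (restr y z) = restr (restr x y) z.
Proof.
rewrite -[LHS](restr_of_outside_zero (outside_outside_restr (compl x) y z)).
exact: restr_outside_restr.
Qed.

(** By left regularity [restr y (restr x z)] has no part outside [x], so it is
    unchanged by [restr x]; left regularity also absorbs the second
    [restr x]. *)
Lemma restrCA x y z : restr x (restr y z) = restr y (restr x z).
Proof.
have x0 : outside x (restr y (restr x z)) = zero.
  rewrite {1}/restr -outside_restr_outside outside_restr.
  by rewrite !outside_zero.
by rewrite -(restr_of_outside_zero x0) /restr outside_restr_outside.
Qed.

Lemma restr0 x : restr x zero = zero.
Proof. exact: outside_zero. Qed.

Lemma zero_restr y : restr zero y = zero.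
Proof. by have := restr_outside zero y; rewrite outside0. Qed.

Lemma restr_comp x f c :
  restr x (alg_comp f c) = alg_comp (fun i => restr x (f i)) c.
Proof. exact: outside_comp. Qed.

Lemma restr_meet x a b :
  restr x (alg_meet a b) = alg_meet (restr x a) (restr x b).
Proof. exact: law11. Qed.

Lemma restr_meet_l a b : restr (alg_meet a b) a = alg_meet a b.
Proof. by rewrite -insideE law12. Qed.

Lemma restr_compl_restr x c : restr (compl x) (restr x c) = zero.
Proof. by rewrite restr_compl outside_restr. Qed.

Lemma restr_restr_compl x c : restr x (restr (compl x) c) = zero.
Proof. by rewrite restr_compl restr_outside. Qed.

Lemma restr_xcompl x : restr x (compl x) = zero.
Proof. by rewrite complE restr_outside. Qed.

Lemma restr_split x d :
  restr x d = zero -> restr (compl x) d = zero -> d = zero.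
Proof.
by rewrite (restr_compl x) => xd /restr_of_outside_zero <-.
Qed.

(** The law [law6] in terms of restrictions: the fold restricts [f i] to the
    common domain of the [f j]. *)
Lemma comp_anti i f b :
  alg_comp f (alg_anti i b) =
  restr (compl (alg_comp f b))
    (foldr (fun j y => restr (f j) y) (f i) (enum 'I_n)).
Proof.
rewrite restr_compl law6 //; congr outside.
by elim: (enum _) => //= j s ->; rewrite insideE.
Qed.

(** The domain of a bowtie b is above every domain on which [a] and [b] agree.
    When both restrict to [g] on [d], [law14] evaluates a bowtie b on [d] as
    the union of the domain of [g] and its complement, so as everything. *)
Lemma restr_agree d a b : restr d a = restr d b ->
  restr d (compl (agree i0 a b)) = zero.
Proof.
move=> dab; set k := agree i0 a b.
set g := restr d a.
have := law14 L i0 a b (compl d).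
rewrite -/k -!/(restr d _) restr_meet -dab -/g law9 // outside_anti_self.
rewrite /join -/(compl g) -!/(compl _).
set al := restr d _; set be := restr d _; set l := outside al _ => lk.
(* [l] lies outside both [al] and [be], which cover [d]: split along [g]. *)
have dl0 : restr d l = zero.
  apply: (@restr_split g); rewrite restrCA.
    have -> : restr g l = restr (dom i0 g) l by rewrite [RHS]restr_compl.
    by rewrite restrA -/al /l restr_outside.
  rewrite restrA -/be /l -restr_compl restrCA restr_xcompl.
  exact: restr0.
rewrite (complE k) {1}/restr outside_outside -/(restr d k) -lk.
rewrite -/(restr l _) -/(restr d _) restrCA restrA dl0.
exact: zero_restr.
Qed.

End BooleanTests.

(** If all the complements of a bowtie_i b were zero, every a bowtie_i b would
    be the projection pi_i, and [law13] with [law2] would give a = b. *)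
Lemma separating_elt n (A : algebra n) (L : laws A) (i0 : 'I_n) (a b : A) :
  a <> b -> exists2 c, c <> zero A &
    forall d, restr i0 d a = restr i0 d b -> restr i0 d c = zero A.
Proof.
move=> ab; apply: contrapT => noc; apply: ab.
have k0 i : alg_anti i (agree i a b) = zero A.
  apply: contrapT => ki; apply: noc; exists (alg_anti i (agree i a b)) => // d.
  rewrite /restr !(outside_anti_indep L i0 i).
  exact: (@restr_agree _ _ L i).
have kE i : agree i a b = proj A i.
  rewrite /proj -(k0 i) {2}/agree /join.
  by rewrite (anti_compl_compl L i).
have := law13 L a b.
by rewrite (_ : (fun i => agree i a b) = @proj _ A) ?comp_proj //; apply/funext.
Qed.

(** * Ultrafilters and germs *)

Section Representation.
Variables (n : nat) (A : algebra n) (L : laws A) (i0 : 'I_n).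
Implicit Types (a b c d x y z : A) (i j k : 'I_n) (f g : 'I_n -> A) (U : set A).

Local Notation "0" := (zero A).
Local Notation m := (restr i0).
Local Notation N := (compl i0).

(** An ultrafilter of the algebra of domains, given by the elements of [A] whose
    domain belongs to it. *)
Definition ultrafilter U : Prop :=
  [/\ ~ U 0, forall x y, U x -> U y -> U (m x y) & forall x, U x \/ U (N x)].

Lemma foldr_restr s x y : foldr m (m x y) s = m x (foldr m y s).
Proof. by elim: s => //= z s ->; rewrite restrCA. Qed.

Lemma foldr_restr0 s : foldr m 0 s = 0.
Proof. by elim: s => //= z s ->; rewrite restr0. Qed.

Lemma foldr_foldr s t y : foldr m (foldr m y t) s = foldr m (foldr m y s) t.
Proof. by elim: s => //= z s ->; rewrite foldr_restr. Qed.

(** A maximal set all of whose finite products, further restricted to [c], are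
    nonzero. *)
Lemma ultrafilter_exists c : c <> 0 -> exists2 U, ultrafilter U & U c.
Proof.
move=> c0; pose fip U := forall s, List.Forall U s -> foldr m c s <> 0.
have [F FP Ftot|U [fipU maxU]] := @Zorn_bigcup A fip.
  move=> s sF.
  have [->//|[X FX sX]] : s = [::] \/ exists2 X, F X & List.Forall X s.
    elim: s sF => [|x s IH]; first by left.
    move=> /List.Forall_cons_iff[[X FX Xx] /IH[->|[Y FY Ys]]]; right.
      by exists X => //; constructor.
    have [XY|YX] := Ftot _ _ FX FY.
      by exists Y => //; constructor => //; exact: XY.
    exists X => //; constructor => //.
    by apply: List.Forall_impl Ys; exact: YX.
  exact: FP sX.
have outU x : ~ U x -> exists2 s, List.Forall U s & m x (foldr m c s) = 0.
  move=> Ux; apply: contrapT => nos; apply: (maxU (U `|` [set x])).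
    split=> [y Uy|/(_ x) UxU]; first by left.
    by apply: Ux; apply: UxU; right.
  move=> s sU s0; apply: nos.
  (* In the product of [s], the occurrences of [x] can be gathered in front. *)
  have [t tU tE] : exists2 t, List.Forall U t &
      m x (foldr m c s) = m x (foldr m c t).
    elim: s sU {s0} => [|y s IH]; first by exists [::].
    move=> /List.Forall_cons_iff[Uxy /IH[t tU tE]].
    case: Uxy => [Uy|->].
      by exists (y :: t); [constructor|rewrite /= !(restrCA L i0 x y) tE].
    by exists t => //=; rewrite restrA ?restrxx.
  by exists t => //; rewrite -tE s0 restr0.
exists U; last first.
  apply: contrapT => /outU[s sU]; rewrite -foldr_restr restrxx //.
  exact: fipU.
split.
- by move=> U0; apply: (fipU [:: 0]); [constructor|rewrite /= zero_restr].
- move=> x y Ux Uy; apply: contrapT => /outU[s sU]; rewrite -restrA //.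
  by apply: (fipU [:: x, y & s]); do 2 constructor => //.
- move=> x; apply: contrapT => /not_orP[/outU[s sU s0] /outU[t tU t0]].
  have : foldr m c (s ++ t) <> 0 by apply: fipU; rewrite Forall_cat.
  apply; apply: (restr_split L (i0 := i0) (x := x)).
    by rewrite foldr_cat foldr_foldr -foldr_restr s0 foldr_restr0.
  by rewrite foldr_cat -foldr_restr t0 foldr_restr0.
Qed.

Definition germ U a b : Prop := exists2 d, U d & m d a = m d b.

Section Germs.
Variables (U : set A) (ufU : ultrafilter U).

Lemma uf0 : ~ U 0. Proof. by case: ufU. Qed.

Lemma uf_restr x y : U x -> U y -> U (m x y).
Proof. by case: ufU => _ + _; apply. Qed.

Lemma uf_compl x : ~ U x -> U (N x).
Proof. by case: ufU => _ _ /(_ x)[]. Qed.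

Lemma germ_refl a : germ U a a.
Proof. by exists (N 0) => //; exact: uf_compl uf0. Qed.

Lemma germ_sym a b : germ U a b -> germ U b a.
Proof. by move=> [d Ud dab]; exists d. Qed.

Lemma germ_trans b a c : germ U a b -> germ U b c -> germ U a c.
Proof.
move=> [d Ud dab] [e Ue ebc]; exists (m d e); first exact: uf_restr.
by rewrite -!restrA // -ebc !(restrCA L i0 d e) dab.
Qed.

Lemma germ_restr d a : U d -> germ U (m d a) a.
Proof. by move=> Ud; exists d => //; rewrite restrA ?restrxx. Qed.

(** Otherwise [U] contains [compl b], [a] and the [d] on which [a] and [b]
    agree, hence their product; but there [a] may be replaced by [b], so the
    product is zero. *)
Lemma germ_mem a b : germ U a b -> U a -> U b.
Proof.
move=> [d Ud dab] Ua; apply: contrapT => /uf_compl UNb; apply: uf0.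
have -> : 0 = m (N b) (m d a).
  rewrite dab restrCA // -(restr0 L i0 d).
  by rewrite -{2}(restrxx L i0 b) restr_compl_restr.
by do 2 apply: uf_restr => //.
Qed.

Lemma germ_zero a : ~ U a -> germ U a 0.
Proof.
move=> /uf_compl UNa; exists (N a) => //.
by rewrite restr0 // -{2}(restrxx L i0 a) restr_compl_restr.
Qed.

Lemma germ_comp f g c : (forall i, germ U (f i) (g i)) ->
  germ U (alg_comp f c) (alg_comp g c).
Proof.
move=> fg.
have [d Ud dfg] : exists2 d, U d & forall i, i \in enum 'I_n ->
    m d (f i) = m d (g i).
  elim: (enum _) => [|j s [d Ud dfg]].
    by exists (N 0) => //; exact: uf_compl uf0.
  have [e Ue efg] := fg j; exists (m e d); first exact: uf_restr.
  move=> i; rewrite -!restrA // inE => /orP[/eqP->|/dfg->//].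
  by rewrite !(restrCA L i0 e d) efg.
exists d => //; rewrite !restr_comp //; congr alg_comp; apply/funext => i.
by apply: dfg; rewrite mem_enum.
Qed.

Lemma comp_mem f c i : U (alg_comp f c) -> U (f i).
Proof.
move=> Ufc; apply: contrapT => /uf_compl UNf; apply: uf0.
have -> : 0 = m (N (f i)) (alg_comp f c); last exact: uf_restr.
rewrite restr_comp //; apply/esym/(comp_zero_arg L (i := i)).
by rewrite -{2}(restrxx L i0 (f i)) restr_compl_restr.
Qed.

(** By [law12], [a] and [b] both agree with their meet on its domain. *)
Lemma germ_meet a b c : U c ->
  germ U (alg_meet a b) c <-> germ U a c /\ germ U b c.
Proof.
move=> Uc; split=> [abc|[[d Ud dac] [e Ue ebc]]].
  have Uab := germ_mem (germ_sym abc) Uc.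
  split; apply: germ_trans abc; exists (alg_meet a b) => //.
    by rewrite restrxx // restr_meet_l.
  by rewrite restrxx // (law10 L) restr_meet_l.
exists (m d e); first exact: uf_restr.
rewrite -!restrA // !restr_meet // ebc !(restrCA L i0 d e) dac.
by rewrite (law9 L).
Qed.

Lemma germ_foldr f a s : (forall i, U (f i)) ->
  germ U (foldr (fun j y => m (f j) y) a s) a.
Proof.
move=> Uf; elim: s => [|j s IH] /=; first exact: germ_refl.
exact: germ_trans (germ_restr _ _) IH.
Qed.

Lemma germ_comp_anti f i b c : (forall j, U (f j)) -> U c ->
  germ U (alg_comp f (alg_anti i b)) c <->
  ~ U (alg_comp f b) /\ germ U (f i) c.
Proof.
move=> Uf Uc; rewrite (comp_anti L i0).
have gf := germ_foldr (f i) (enum 'I_n) Uf.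
split=> [gc|[/uf_compl UN fc]]; last first.
  exact: germ_trans (germ_restr _ _) (germ_trans gf fc).
have [Ub|nUb] := pselect (U (alg_comp f b)).
  case: uf0; have := uf_restr Ub (germ_mem (germ_sym gc) Uc).
  by rewrite restr_restr_compl.
split=> //; apply: germ_trans gc; apply: germ_sym.
exact: germ_trans (germ_restr _ (uf_compl nUb)) gf.
Qed.

End Germs.

(** A choice from [P] that depends on [P] alone, by [some_in_eq]; it selects a
    canonical representative in each class of germs. *)
Definition some_in (P : set A) (ex : exists x, P x) : A := projT1 (cid ex).

Lemma some_in_eq (P Q : set A) (exP : exists x, P x) (exQ : exists x, Q x) :
  P = Q -> some_in exP = some_in exQ.
Proof. by move=> PQ; subst Q; congr some_in; exact: Prop_irrelevance. Qed.

(** The quotient of the members of an ultrafilter by equality of germs, realised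
    by canonical representatives, for all ultrafilters at once. *)
Record point := Point {
  pt_uf : set A;
  pt_elt : A;
  pt_ultra : ultrafilter pt_uf;
  pt_mem : pt_uf pt_elt;
  pt_canon : pt_elt =
    some_in (ex_intro (germ pt_uf pt_elt) _ (germ_refl pt_ultra pt_elt))
}.

Lemma germ_eq U (ufU : ultrafilter U) a b : germ U a b -> germ U a = germ U b.
Proof.
move=> ab; apply/predeqP => c; split; apply: germ_trans => //.
exact: germ_sym.
Qed.

Lemma point_eq (p q : point) : pt_uf p = pt_uf q ->
  germ (pt_uf p) (pt_elt p) (pt_elt q) -> p = q.
Proof.
case: p q => [U a ufU Ua ca] [V b ufV Vb cb] /= UV; subst V => ab.
have E : a = b.
  rewrite ca cb; apply: some_in_eq; exact: germ_eq.
subst b; rewrite (Prop_irrelevance ufV ufU) in cb *.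
by rewrite (Prop_irrelevance Vb Ua) (Prop_irrelevance cb ca).
Qed.

Lemma point_exists U a : ultrafilter U -> U a ->
  exists p : point, pt_uf p = U /\ germ U (pt_elt p) a.
Proof.
move=> ufU Ua; have exa := ex_intro (germ U a) _ (germ_refl ufU a).
have ga : germ U a (some_in exa) by rewrite /some_in; case: cid.
have Us := germ_mem ufU ga Ua.
unshelve eexists (@Point U (some_in exa) ufU Us _); last first.
  by split=> //; exact: germ_sym.
by apply: some_in_eq; exact: germ_eq.
Qed.

(** * The representation *)

(** The partial function (x_1, ..., x_n) |-> <x_1, ..., x_n>; b on germs. Its
    domain condition, that the composite belongs to the ultrafilter, is
    implicit in its having the germ of a point. *)
Definition theta b : set (('I_n -> point) * point) :=
  [set p | (forall i, pt_uf (p.1 i) = pt_uf p.2) /\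
     germ (pt_uf p.2) (alg_comp (fun i => pt_elt (p.1 i)) b) (pt_elt p.2)].

Definition same_uf (p q : point) : Prop := pt_uf p = pt_uf q.

Lemma same_uf_equivalence : RelationClasses.Equivalence same_uf.
Proof.
split=> [p//|p q|p q r]; rewrite /same_uf; first by move=> ->.
by move=> ->.
Qed.

Lemma theta_pfun b : is_pfun (theta b).
Proof.
move=> x y z [/= xy gy] [/= xz gz].
have yz : pt_uf y = pt_uf z by rewrite -(xy i0) xz.
apply: point_eq => //; rewrite -yz in gz.
exact (germ_trans (pt_ultra y) (germ_sym gy) gz).
Qed.

Lemma theta_eqv b : pairwise_eqv same_uf (theta b).
Proof. by move=> x z [/= xz _]; split=> [i j|i]; rewrite /same_uf !xz. Qed.

Lemma theta_comp f b :
  theta (alg_comp f b) = pf_comp (fun i => theta (f i)) (theta b).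
Proof.
apply/predeqP => -[x z]; split.
  move=> [/= xz gz]; rewrite -(law1 L) in gz.
  have ufU := pt_ultra z.
  have Ufb := germ_mem ufU (germ_sym gz) (pt_mem z).
  have pE i := point_exists ufU (comp_mem ufU i Ufb).
  pose y i := projT1 (cid (pE i)); exists y.
  have yU i : pt_uf (y i) = pt_uf z by rewrite /y; case: cid => p [].
  have yg i : germ (pt_uf z) (pt_elt (y i))
      (alg_comp (fun j => pt_elt (x j)) (f i)).
    by rewrite /y; case: cid => p [].
  split=> [i|]; split=> //=.
  - by move=> j; rewrite yU xz.
  - by rewrite yU; apply: germ_sym; exact: yg.
  - by apply: (germ_trans ufU (germ_comp ufU _ _) gz).
move=> [y [/= xy [/= yz gz]]]; split=> /= [i|].
  by have [/= -> _] := xy i; rewrite yz.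
have ufU := pt_ultra z.
rewrite -(law1 L); apply: (germ_trans ufU (germ_comp ufU _ _) gz).
by move=> i; have [/= _] := xy i; rewrite yz.
Qed.

Lemma theta_anti i b : theta (alg_anti i b) = pf_antidom same_uf i (theta b).
Proof.
apply/predeqP => -[x z]; split.
  move=> [/= xz gz]; have ufU := pt_ultra z.
  have Ux j : pt_uf z (pt_elt (x j)) by rewrite -(xz j); exact: pt_mem.
  have [nU xi] := (germ_comp_anti ufU i b Ux (pt_mem z)).1 gz.
  split=> /=; first by apply: point_eq => //; apply: germ_sym.
    by move=> j k; rewrite /same_uf !xz.
  move=> [y [/= xy gy]]; apply: nU.
  have E : pt_uf y = pt_uf z by rewrite -(xy i) xz.
  rewrite E in gy; apply: (germ_mem ufU (germ_sym gy) _).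
  by rewrite -E; exact: pt_mem.
move=> [/= -> xx noy]; have ufU := pt_ultra (x i).
have Ux j : pt_uf (x i) (pt_elt (x j)) by rewrite -(xx j i); exact: pt_mem.
split=> /= [j|]; first exact: xx.
apply/(germ_comp_anti ufU) => //; split; last exact: germ_refl.
move=> Ub; apply: noy; have [p [pU pg]] := point_exists ufU Ub.
exists p; split=> /= [j|]; first by rewrite pU; exact: xx.
by rewrite pU; exact: germ_sym.
Qed.

Lemma theta_meet a b : theta (alg_meet a b) = theta a `&` theta b.
Proof.
apply/predeqP => -[x z]; have gm := germ_meet (pt_ultra z) _ _ (pt_mem z).
rewrite /theta /= (law11 L); split=> [[xz /gm[]]//|[[xz ga] [_ gb]]].
by split=> //; apply/gm.
Qed.

(** The point of the base where [a] and [b] differ is the tuple of the germs of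
    the projections pi_i, on which [b] takes the germ of [b] itself. *)
Lemma theta_inj a b : theta a = theta b -> a = b.
Proof.
move=> ab; apply: contrapT => /(separating_elt L i0)[c c0 sep].
have [U ufU Uc] := ultrafilter_exists c0.
have nab : ~ germ U a b.
  move=> [d Ud /sep dc]; apply: (uf0 ufU); rewrite -dc; exact: uf_restr.
have UP i : U (proj A i).
  apply: contrapT => /(uf_compl ufU) UN; apply: (uf0 ufU).
  have := uf_restr ufU UN Uc.
  rewrite -{1}(comp_proj L c) restr_comp // (comp_zero_arg L (i := i)) //.
  by rewrite -{2}(restrxx L i0 (proj A i)) restr_compl_restr.
have pE i := point_exists ufU (UP i).
pose x i := projT1 (cid (pE i)).
have xU i : pt_uf (x i) = U by rewrite /x; case: cid => p [].
have xg e : germ U (alg_comp (fun i => pt_elt (x i)) e) e.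
  rewrite -{2}(comp_proj L e); apply: germ_comp => // i.
  by rewrite /x; case: cid => p [].
have half u v : theta u = theta v -> U u -> germ U u v.
  move=> uv Uu; have [z [zU zg]] := point_exists ufU Uu.
  have : theta u (x, z).
    split=> /= [i|]; first by rewrite xU zU.
    by rewrite zU; exact: (germ_trans ufU (xg u) (germ_sym zg)).
  rewrite uv => -[/= _]; rewrite zU => vz.
  exact: (germ_trans ufU (germ_trans ufU (germ_sym zg) (germ_sym vz)) (xg v)).
have [Ua|Ua] := pselect (U a); first exact/nab/half.
have [Ub|Ub] := pselect (U b).
  by apply/nab/germ_sym/half.
apply: nab.
exact: (germ_trans ufU (germ_zero ufU Ua) (germ_sym (germ_zero ufU Ub))).
Qed.

Definition theta_elts : set (set (('I_n -> point) * point)) :=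
  [set s | exists b, s = theta b].

Definition theta_algebra : pfun_algebra n.
Proof.
refine (@PFunAlgebra n point same_uf same_uf_equivalence theta_elts
  _ _ _ _ _ _).
- by exists (theta 0); exists 0.
- by move=> _ [b ->]; exact: theta_pfun.
- by move=> _ [b ->]; exact: theta_eqv.
- move=> f _ fE [b ->]; pose h i := projT1 (cid (fE i)).
  exists (alg_comp h b); rewrite theta_comp; congr pf_comp.
  by apply/funext => i; rewrite /h; case: cid.
- by move=> i _ [b ->]; exists (alg_anti i b); rewrite theta_anti.
- by move=> _ _ [a ->] [b ->]; exists (alg_meet a b); rewrite theta_meet.
Defined.

Lemma laws_representable : representable A.
Proof.
exists theta_algebra.
pose h b : algebra_of_pfuns theta_algebra :=
  exist (pf_elts theta_algebra) (theta b) (ex_intro _ b erefl).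
exists h; split.
  split=> *; apply: eq_exist => /=.
  - exact: theta_comp.
  - exact: theta_anti.
  - exact: theta_meet.
exists (fun s : algebra_of_pfuns theta_algebra =>
  projT1 (@cid A (fun b => proj1_sig s = theta b) (proj2_sig s))).
  move=> b; case: cid => a /= E; exact/theta_inj.
by move=> [s Es]; apply: eq_exist => /=; case: cid.
Qed.

End Representation.

(** * Soundness *)

Section Soundness.
Variables (n : nat) (P : pfun_algebra n) (i0 : 'I_n).
Local Notation B := (algebra_of_pfuns P).
Local Notation X := (pf_base P).
Local Notation E := (@pf_eqv n P).
Implicit Types (a b d f g : B) (x y : 'I_n -> X) (z w : X) (i j k : 'I_n).

Definition graph f x z : Prop := proj1_sig f (x, z).
Definition defined f x : Prop := exists z, graph f x z.
Definition diagonal x : Prop := forall j k, E (x j) (x k).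

Lemma graph_ext f g : (forall x z, graph f x z <-> graph g x z) -> f = g.
Proof.
case: f g => [f Pf] [g Pg] fg; apply: eq_exist; apply/predeqP => -[x z].
exact: fg.
Qed.

Lemma graph_fun f x z w : graph f x z -> graph f x w -> z = w.
Proof. exact: (pf_elts_pfun (proj2_sig f)). Qed.

Lemma graph_diagonal f x z : graph f x z -> diagonal x.
Proof. by move=> /(pf_elts_eqv (proj2_sig f))[]. Qed.

Lemma graph_comp (h : 'I_n -> B) g x z :
  graph (alg_comp h g) x z <->
  exists y, (forall i, graph (h i) x (y i)) /\ graph g y z.
Proof. by []. Qed.

Lemma graph_meet f g x z :
  graph (alg_meet f g) x z <-> graph f x z /\ graph g x z.
Proof. by []. Qed.

Lemma graph_anti i f x z :
  graph (alg_anti i f) x z <-> (z = x i /\ diagonal x /\ ~ defined f x).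
Proof. by split=> [[]//|[? []]]. Qed.

Lemma defined_anti i f x :
  defined (alg_anti i f) x <-> diagonal x /\ ~ defined f x.
Proof.
by split=> [[z /graph_anti[_]]//|[dx nf]]; exists (x i); apply/graph_anti.
Qed.

Lemma graph_outside d f x z :
  graph (outside d f) x z <-> ~ defined d x /\ graph f x z.
Proof.
rewrite graph_comp; split=> [[y [xy yz]]|[nd xz]].
  have yE : y = x by apply/funext => i; have /graph_anti[] := xy i.
  by subst y; split=> //; have /graph_anti[_ []] := xy i0.
exists x; split=> // i; apply/graph_anti; split=> //; split=> //.
exact: (graph_diagonal xz).
Qed.

Lemma defined_outside d f x :
  defined (outside d f) x <-> ~ defined d x /\ defined f x.
Proof.
split=> [[z /graph_outside[nd fz]]|[nd [z fz]]]; first by split=> //; exists z.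
by exists z; apply/graph_outside.
Qed.

Lemma graph_dom i f x z :
  graph (dom i f) x z <-> (z = x i /\ diagonal x /\ defined f x).
Proof.
rewrite graph_anti defined_anti; split=> -[-> [dx]].
  by move=> /not_andP[//|/contrapT].
by move=> fx; split=> //; split=> // -[].
Qed.

Lemma defined_dom i f x : defined (dom i f) x <-> defined f x.
Proof.
split=> [[z /graph_dom[_ []]]//|fx]; exists (x i); apply/graph_dom.
by split=> //; split=> //; case: fx => z /graph_diagonal.
Qed.

Lemma graph_inside d f x z :
  graph (inside d f) x z <-> defined d x /\ graph f x z.
Proof.
have -> : inside d f = outside (alg_anti i0 d) f.
  congr alg_comp; apply/funext => i; apply: graph_ext => {}x {}z.
  by rewrite !graph_anti !defined_anti.
rewrite graph_outside defined_anti; split=> -[h xz]; split=> //.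
  by apply: contrapT => nd; apply: h; split=> //; exact: (graph_diagonal xz).
by case.
Qed.

Lemma graph_join i f g x z :
  graph (join i f g) x z <->
  (z = x i /\ diagonal x /\ (defined f x \/ defined g x)).
Proof.
rewrite graph_anti defined_outside defined_anti.
split=> -[-> [dx h]]; do 2 split=> //.
  by apply: contrapT => /not_orP[nf ng]; apply: h.
by case: h => h [] // nf [].
Qed.

Definition agree_at f g x : Prop :=
  defined (alg_meet f g) x \/ ~ defined f x /\ ~ defined g x.

Lemma graph_agree i f g x z :
  graph (agree i f g) x z <-> (z = x i /\ diagonal x /\ agree_at f g x).
Proof.
rewrite graph_join defined_dom defined_outside defined_anti /agree_at.
by split=> -[-> [dx h]]; tauto.
Qed.

Lemma graph_comp_agree f g (h : B) x z :
  graph (alg_comp (fun i => agree i f g) h) x z <->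
  agree_at f g x /\ graph h x z.
Proof.
rewrite graph_comp; split=> [[y [xy yz]]|[fg xz]].
  have yE : y = x by apply/funext => i; have /graph_agree[] := xy i.
  by subst y; split=> //; have /graph_agree[_ []] := xy i0.
exists x; split=> // i; apply/graph_agree; split=> //; split=> //.
exact: (graph_diagonal xz).
Qed.

Lemma graph_zero f x z : ~ graph (outside f f) x z.
Proof. by move=> /graph_outside[nf fz]; apply: nf; exists z. Qed.

Lemma graph_foldr_inside (h : 'I_n -> B) f (s : seq 'I_n) x z :
  graph (foldr (fun j t => inside (h j) t) f s) x z <->
  (forall j, j \in s -> defined (h j) x) /\ graph f x z.
Proof.
elim: s => [|j s IH]; first by split=> [|[]].
rewrite -[foldr _ f (j :: s)]/(inside (h j) (foldr _ f s)) graph_inside IH.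
split=> [[hj [hs fz]]|[hs fz]].
  by split=> // k; rewrite inE => /orP[/eqP->|/hs].
split; first by apply: hs; rewrite mem_head.
by split=> // k ks; apply: hs; rewrite inE ks orbT.
Qed.

Lemma defined_meet f g x :
  defined (alg_meet f g) x <-> exists2 z, graph f x z & graph g x z.
Proof. by split=> -[z]; [case; exists z|exists z; split]. Qed.

(** Each law is checked on graphs. Where a composition occurs in a composition,
    the intermediate tuples agree because the elements are functions; the index
    [i0] supplies an intermediate tuple in [law1]. *)
Lemma pfun_laws : laws B.
Proof.
split.
- move=> h g c; apply: graph_ext => x z; split.
    move=> [y [xy yz]]; have [w [xw wy]] := xy i0.
    exists w; split=> //; exists y; split=> // i.
    have [v [xv vy]] := xy i.
    suff -> : w = v by [].
    by apply/funext => j; exact: (graph_fun (xw j) (xv j)).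
  move=> [w [xw [y [wy yz]]]]; exists y; split=> // i.
  by exists w; split=> //; exact: wy.
- move=> a c; apply: graph_ext => x z.
  have undef : ~ defined (outside c c) x by move=> [w /graph_zero].
  split=> [[y [xy yz]]|xz].
    suff <- : y = x by [].
    by apply/funext => i; have /graph_anti[] := xy i.
  exists x; split=> // i; apply/graph_anti; split=> //; split=> //.
  exact: (graph_diagonal xz).
- by move=> a b; apply: graph_ext => x z; split=> /graph_zero.
- move=> i h b c; apply: graph_ext => x z; split=> [[y [/(_ i)]]|/graph_zero//].
  by rewrite eqxx => /graph_zero.
- move=> h c; apply: graph_ext => x z.
  by split=> [[y [_ /graph_zero]]|/graph_zero].
- move=> i h b; apply: graph_ext => x z.
  rewrite graph_outside graph_foldr_inside; split.
    move=> [y [xy /graph_anti[/= -> [dy nb]]]]; split.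
      move=> [w [v [xv vw]]]; apply: nb; exists w.
      suff -> : y = v by [].
      by apply/funext => j; exact: (graph_fun (xy j) (xv j)).
    by split=> [j _|]; [exists (y j)|]; exact: xy.
  move=> [nb [hdef hz]].
  have ex j : exists w, graph (h j) x w by apply: hdef; rewrite mem_enum.
  pose y j := projT1 (cid (ex j)).
  have xy j : graph (h j) x (y j) by rewrite /y; case: cid.
  exists y; split=> //; apply/graph_anti; split; [|split].
  + exact: (graph_fun hz (xy i)).
  + move=> j k; have [eqv_refl eqv_sym eqv_trans] := pf_eqv_equivalence P.
    have [_ xj] := pf_elts_eqv (proj2_sig (h j)) (xy j).
    have [_ xk] := pf_elts_eqv (proj2_sig (h k)) (xy k).
    exact: (eqv_trans _ _ _ (eqv_sym _ _ (xj i0)) (xk i0)).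
  + by move=> [w yw]; apply: nb; exists w, y.
- move=> a; apply: graph_ext => x z; rewrite graph_inside.
  by split=> [[]//|xz]; split=> //; exists z.
- move=> i j k a; apply: graph_ext => x z.
  by rewrite !graph_anti !defined_anti.
- by move=> a; apply: graph_ext => x z; rewrite graph_meet; tauto.
- by move=> a b; apply: graph_ext => x z; rewrite !graph_meet; tauto.
- move=> h b c; apply: graph_ext => x z; split.
    by move=> [y [xy [yb yc]]]; split; exists y.
  move=> [[y [xy yb]] [w [xw wc]]]; exists y; split=> //; split=> //.
  suff -> : y = w by [].
  by apply/funext => i; exact: (graph_fun (xy i) (xw i)).
- move=> a b; apply: graph_ext => x z; rewrite graph_inside graph_meet.
  rewrite defined_meet; split=> [[[w aw bw] az]|[az bz]].
    by split=> //; rewrite (graph_fun az aw).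
  by split=> //; exists z.
- move=> a b; apply: graph_ext => x z; rewrite !graph_comp_agree.
  split=> -[ab xz]; split=> //; case: (ab).
  + by move=> [w [aw bw]]; rewrite (graph_fun xz aw).
  + by move=> [na _]; case: na; exists z.
  + by move=> [w [aw bw]]; rewrite (graph_fun xz bw).
  + by move=> [_ nb]; case: nb; exists z.
- move=> i a b d; apply: graph_ext => x z.
  rewrite graph_join graph_outside graph_agree /agree_at !defined_outside.
  rewrite defined_dom defined_anti !defined_outside.
  by split; [move=> [-> [dx h]]|move=> [nd [-> [dx h]]]]; do ?split=> //; tauto.
- move=> i a b c; apply: graph_ext => x z.
  have agreeE : defined (agree i b c) x <-> diagonal x /\ agree_at b c x.
    split=> [[w /graph_agree[_]]//|[dx bc]].
    by exists (x i); apply/graph_agree.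
  have insideE : defined (inside a (agree i b c)) x <->
      defined a x /\ defined (agree i b c) x.
    split=> [[w /graph_inside[da ww]]|[da [w ww]]].
      by split=> //; exists w.
    by exists w; apply/graph_inside.
  rewrite graph_join graph_agree insideE defined_outside agreeE.
  have [da|nda] := pselect (defined a x);
    by split=> -[-> [dx h]]; tauto.
Qed.

End Soundness.

(** * Preservation of equations *)

Section Homomorphisms.
Variable n : nat.

Lemma hom_eval (A B : algebra n) (h : A -> B) (v : nat -> A) t :
  is_hom h -> h (eval v t) = eval (h \o v) t.
Proof.
move=> [hc ha hm]; elim: t => //= [ts IH u IHu|i u IHu|u IHu w IHw].
- by rewrite hc IHu; congr alg_comp; apply/funext.
- by rewrite ha IHu.
- by rewrite hm IHu IHw.
Qed.

Lemma satisfies_image (A B : algebra n) (h : A -> B) e :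
  is_hom h -> (forall b, exists a, h a = b) -> satisfies A e -> satisfies B e.
Proof.
move=> hh surj Ae v; pose w k := projT1 (cid (surj (v k))).
have -> : v = h \o w by apply/funext => k; rewrite /w /=; case: cid.
by rewrite -!hom_eval // Ae.
Qed.

Lemma satisfies_sub (A B : algebra n) (h : B -> A) e :
  is_hom h -> injective h -> satisfies A e -> satisfies B e.
Proof. by move=> hh inj Ae v; apply: inj; rewrite !hom_eval. Qed.

Lemma satisfies_prod (I : Type) (A : I -> algebra n) e :
  (forall i, satisfies (A i) e) -> satisfies (prod_algebra A) e.
Proof.
move=> Ae v; apply: functional_extensionality_dep => i.
have proj_hom : is_hom (fun f : prod_algebra A => f i) by [].
by have := Ae i (fun k => v k i); rewrite -!(hom_eval _ _ proj_hom).
Qed.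

End Homomorphisms.

(** * The theorem *)

Theorem theorem6p5 (n : nat) (hn : 1 <= n) :
  is_variety (@representable n) /\
  finitely_axiomatised_by (@representable n) (axioms n).
Proof.
have axiomatised : finitely_axiomatised_by (@representable n) (axioms n).
  have i0 : 'I_n := Ordinal hn.
  move=> A; split=> [[P [h [hh /bij_inj injh]]]|].
    have := (axioms_laws _).2 (pfun_laws P i0).
    by apply: List.Forall_impl => e; exact: satisfies_sub hh injh.
  by move=> /axioms_laws LA; exact: laws_representable LA i0.
split=> //; split.
- move=> A B h hh surj /axiomatised Aax; apply/axiomatised.
  by apply: List.Forall_impl Aax => e; exact: satisfies_image hh surj.
- move=> A B h hh inj /axiomatised Aax; apply/axiomatised.
  by apply: List.Forall_impl Aax => e; exact: satisfies_sub hh inj.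
- move=> I A Aax; apply/axiomatised/List.Forall_forall => e ein.
  apply: satisfies_prod => i.
  by have /axiomatised/List.Forall_forall := Aax i; apply.
Qed.
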